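(* Consider the stochastic multi-symplectic system $$M\,d\mathbf z+K\mathbf z_x\,dt=\nabla_{\mathbf z}S_1(\mathbf z)\,dt+\mathcal G\,dW(t),\qquad \mathbf z=[u,\phi,w,v,p]^{\mathrm T},$$ with $S_1(\mathbf z)=-wu-\frac12u^3-\frac12up^2+pv$ and $$M=\begin{bmatrix}0&\frac12&0&0&-\frac12\\-\frac12&0&0&0&0\\0&0&0&0&0\\0&0&0&0&0\\\frac12&0&0&0&0\end{bmatrix},\quad K=\begin{bmatrix}0&0&0&-1&0\\0&0&1&0&0\\0&-1&0&0&0\\1&0&0&0&0\\0&0&0&0&0\end{bmatrix},\quad \mathcal Gh=\frac12\begin{bmatrix}\partial_x^{-1}\Phi h\\-\Lambda\Phi h\\0\\0\\\Lambda\Phi h\end{bmatrix}.$$ Assume that this system admits a solution $\mathbf z$ such that $\mathbf z$ is sufficiently regular in the spatial variable and $\mathbf z_x$ is well defined, and such that the phase-space variation $\xi=\mathbf d\mathbf z$ exists and is sufficiently regular. Then the local stochastic multi-symplectic conservation law $$d\omega+\partial_x\kappa\,dt=0\qquad\text{a.s.}$$ holds, where $$\omega=\tfrac12\,\mathbf d\mathbf z\wedge M\mathbf d\mathbf z=\tfrac12\,\mathbf du\wedge\mathbf d\phi-\tfrac12\,\mathbf du\wedge\mathbf dp,\qquad \kappa=\tfrac12\,\mathbf d\mathbf z\wedge K\mathbf d\mathbf z=-\mathbf du\wedge\mathbf dv+\mathbf d\phi\wedge\mathbf dw.$$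
   Context: $\mathbb T_L=\mathbb R/L\mathbb Z$ is identified with the periodic interval $[a,b)$, $L=b-a$, $\mu=2\pi/L$; spatial operators are periodic. $H_0^r(\mathbb T_L)$ is the subspace of zero-mean functions in $H^r(\mathbb T_L)$. $\Lambda:=(1-\partial_x^2)^{-1}$; $\partial_x^{-1}$ is the zero-mean antiderivative on zero-mean functions. $W$ is a cylindrical Wiener process on $\mathcal U=L_0^2(\mathbb T_L)$ (zero-mean $L^2$ functions) and $\Phi\in\mathcal L_2(\mathcal U;H_0^{s-2}(\mathbb T_L))$ (Hilbert--Schmidt) with $s>5/2$. The symbol $\mathbf d$ denotes the exterior derivative with respect to the phase variables (so $\xi=\mathbf d\mathbf z$ is the variation of the solution with respect to the phase variables, for a fixed noise realization; the noise operator $\mathcal G$ does not depend on the phase variables), whereas $d$ denotes the stochastic time differential. For vectors of one-forms $\alpha,\beta$, $\alpha\wedge\beta=\sum_i\alpha_i\wedge\beta_i$. *)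

(* Defs.v *)
From HB Require Import structures.
From mathcomp Require Import all_boot all_order all_algebra.
From mathcomp Require Import all_classical all_reals all_analysis.

Set Implicit Arguments.
Unset Strict Implicit.
Unset Printing Implicit Defensive.

Import Order.TTheory GRing.Theory Num.Theory.
Import numFieldNormedType.Exports.

Local Open Scope classical_set_scope.
Local Open Scope ring_scope.

Local Notation leb := (@lebesgue_measure _).

(** Functions on the torus R/LZ, L = b - a, are L-periodic functions R -> R. *)

Section Torus.
Context {R : realType}.
Variables a b : R.

Definition torus_length : R := b - a.
Definition wave_number : R := 2 * pi / torus_length.

Definition inner (f g : R -> R) : R := \int[leb]_(x in `[a, b]) (f x * g x).

Record L2_zero_mean (f : R -> R) : Prop := {
  L2_periodic : periodic f torus_length;
  L2_measurable : measurable_fun setT f;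
  L2_integrable : leb.-integrable `[a, b] (EFin \o (fun x => f x ^+ 2));
  L2_mean0 : \int[leb]_(x in `[a, b]) f x = 0 }.

(* real and (minus the) imaginary part of
   L^-1 * \int_a^b f(x) exp(- i mu k (x - a)) dx *)
Definition fourier_cos (f : R -> R) (k : int) : R :=
  torus_length^-1 *
  \int[leb]_(x in `[a, b]) (f x * cos (wave_number * k%:~R * (x - a))).
Definition fourier_sin (f : R -> R) (k : int) : R :=
  torus_length^-1 *
  \int[leb]_(x in `[a, b]) (f x * sin (wave_number * k%:~R * (x - a))).

(* L * \sum_(k in Z) (1 + (mu k)^2)^r |f^(k)|^2 *)
Definition sobolev_norm2 (r : R) (f : R -> R) : \bar R :=
  \esum_(k in [set: int])
    (torus_length * ((1 + (wave_number * k%:~R) ^+ 2) `^ r *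
       (fourier_cos f k ^+ 2 + fourier_sin f k ^+ 2)))%:E.

(* For r > 1/2 every class of H_0^r has exactly one continuous representative,
   and elements of H_0^r are identified with it; this definition is only used
   for such r. *)
Definition H0 (r : R) (f : R -> R) : Prop :=
  [/\ L2_zero_mean f, continuous f & (sobolev_norm2 r f < +oo)%E].

(* The two inverses below are uniquely determined, and exist for every f in
   H_0^r, r > 1/2. *)
Definition dx_inv (f : R -> R) : R -> R :=
  xget (fun=> 0) [set F : R -> R |
    [/\ periodic F torus_length, forall x : R, is_derive x 1 F (f x)
      & \int[leb]_(x in `[a, b]) F x = 0]].

Definition Lambda (f : R -> R) : R -> R :=
  xget (fun=> 0) [set g : R -> R |
    [/\ periodic g torus_length, forall x : R, derivable g x 1,
        forall x : R, derivable (derive1 g) x 1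
      & forall x, g x - derive1 (derive1 g) x = f x]].

Record orthonormal_basis (e : nat -> R -> R) : Prop := {
  onb_mem : forall k, L2_zero_mean (e k);
  onb_orthonormal : forall j k, inner (e j) (e k) = (j == k)%:R;
  onb_complete : forall f, L2_zero_mean f -> (forall k, inner f (e k) = 0) ->
    {ae leb, forall x : R, a <= x <= b -> f x = 0} }.

(* Phi in L_2(L_0^2; H_0^r); boundedness forces Phi to respect a.e. equality *)
Record hilbert_schmidt (r : R) (Phi : (R -> R) -> (R -> R)) : Prop := {
  hs_mem : forall h, L2_zero_mean h -> H0 r (Phi h);
  hs_linear : forall (c : R) g h, L2_zero_mean g -> L2_zero_mean h ->
    Phi (fun x => c * g x + h x) = (fun x => c * Phi g x + Phi h x);
  hs_bounded : exists C : R, forall h, L2_zero_mean h ->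
    (sobolev_norm2 r (Phi h) <= (C * inner h h)%:E)%E;
  hs_summable : exists2 e, orthonormal_basis e &
    (\esum_(k in [set: nat]) sobolev_norm2 r (Phi (e k)) < +oo)%E }.

End Torus.

Section System.
Context {R : realType}.

Definition iu : 'I_5 := @Ordinal 5 0 isT.
Definition iphi : 'I_5 := @Ordinal 5 1 isT.
Definition iw : 'I_5 := @Ordinal 5 2 isT.
Definition iv : 'I_5 := @Ordinal 5 3 isT.
Definition ip : 'I_5 := @Ordinal 5 4 isT.

Definition mx_of_rows (n : nat) (rows : seq (seq R)) : 'M[R]_n :=
  \matrix_(i < n, j < n) nth 0 (nth [::] rows i) j.
Definition col_of_seq (n : nat) (l : seq R) : 'cV[R]_n :=
  \col_(i < n) nth 0 l i.

Definition M_mx : 'M[R]_5 := mx_of_rows 5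
  [:: [::      0; 1 / 2; 0; 0; - (1 / 2)];
      [:: - (1 / 2); 0; 0; 0; 0];
      [::      0;    0; 0; 0; 0];
      [::      0;    0; 0; 0; 0];
      [::  1 / 2;    0; 0; 0; 0]].

Definition K_mx : 'M[R]_5 := mx_of_rows 5
  [:: [:: 0;  0; 0; -1; 0];
      [:: 0;  0; 1;  0; 0];
      [:: 0; -1; 0;  0; 0];
      [:: 1;  0; 0;  0; 0];
      [:: 0;  0; 0;  0; 0]].

Definition S1 (z : 'cV[R]_5) : R :=
  let u := z iu 0 in let w := z iw 0 in let v := z iv 0 in let p := z ip 0 in
  - (w * u) - 1 / 2 * u ^+ 3 - 1 / 2 * u * p ^+ 2 + p * v.

Definition gradient (n : nat) (S : 'cV[R]_n.+1 -> R) (z : 'cV[R]_n.+1) :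
    'cV[R]_n.+1 :=
  \col_(i < n.+1) 'D_(delta_mx i 0) S z.

Definition noise_operator (a b : R) (Phi : (R -> R) -> (R -> R))
    (h : R -> R) (x : R) : 'cV[R]_5 :=
  (1 / 2) *: col_of_seq 5
    [:: dx_inv a b (Phi h) x; - Lambda a b (Phi h) x; 0; 0;
        Lambda a b (Phi h) x].

Definition time_integral (n : nat) (F : R -> 'cV[R]_n) (t : R) : 'cV[R]_n :=
  \col_(i < n) \int[leb]_(r in `[0, t]) F r i 0.

End System.

Section Noise.
Context {R : realType} {d : measure_display} {Omega : measurableType d}.
Variable P : probability Omega R.

Definition independent_rvs (n : nat) (X : 'I_n -> Omega -> R) : Prop :=
  forall A : 'I_n -> set R, (forall i, measurable (A i)) ->
    P (\bigcap_(i in [set: 'I_n]) (X i @^-1` A i)) =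
    (\prod_(i < n) P (X i @^-1` A i))%E.

Record brownian_motion (B : R -> Omega -> R) : Prop := {
  bm_measurable : forall t, 0 <= t -> measurable_fun setT (B t);
  bm_start : {ae P, forall w, B 0 w = 0};
  bm_continuous : {ae P, forall w,
    {within [set t : R | 0 <= t], continuous (B ^~ w)}};
  bm_gaussian : forall s t : R, 0 <= s -> s < t ->
    forall A : set R, measurable A ->
    P ((fun w => B t w - B s w) @^-1` A) = normal_prob 0 (Num.sqrt (t - s)) A;
  bm_increments : forall (n : nat) (t : nat -> R), 0 <= t 0%N ->
    (forall i, t i <= t i.+1) ->
    independent_rvs (fun (i : 'I_n) w => B (t i.+1) w - B (t i) w) }.

(* finite-dimensional rectangles generate the sigma-algebra of a process *)
Definition independent_processes (B : nat -> R -> Omega -> R) : Prop :=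
  forall (n m : nat) (t : 'I_n -> 'I_m -> R) (A : 'I_n -> 'I_m -> set R),
    (forall k j, 0 <= t k j) -> (forall k j, measurable (A k j)) ->
    P (\bigcap_(k in [set: 'I_n]) \bigcap_(j in [set: 'I_m])
         (B k (t k j) @^-1` A k j)) =
    (\prod_(k < n)
       P (\bigcap_(j in [set: 'I_m]) (B k (t k j) @^-1` A k j)))%E.

(* W(t) = \sum_k beta_k(t) e_k, a formal series in L_0^2 *)
Record cylindrical_wiener (a b : R) (e : nat -> R -> R)
    (beta : nat -> R -> Omega -> R) : Prop := {
  cw_basis : orthonormal_basis a b e;
  cw_brownian : forall k, brownian_motion (beta k);
  cw_independent : independent_processes beta }.

(* GW is (the version with continuous sample functions of) \int_0^t G dW: since
   the integrand is deterministic and constant in time, the stochastic integral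
   is the limit of \sum_(k < n) beta_k(t) G e_k in L^2(Omega; (H^r)^5). *)
Record noise_process (a b r : R) (e : nat -> R -> R)
    (beta : nat -> R -> Omega -> R) (G : (R -> R) -> R -> 'cV[R]_5)
    (GW : Omega -> R -> R -> 'cV[R]_5) : Prop := {
  np_measurable : forall (t x : R) (i : 'I_5), 0 <= t ->
    measurable_fun setT (fun w => GW w t x i 0);
  np_periodic : forall w t, periodic (GW w t) (torus_length a b);
  np_continuous : {ae P, forall w,
    {within [set q : R * R | 0 <= q.1], continuous (fun q => GW w q.1 q.2)}};
  np_limit : forall t, 0 <= t ->
    (fun n => \int[P]_w \sum_(i < 5) sobolev_norm2 a b r
       (fun x => GW w t x i 0 - \sum_(k < n) beta k t w * G (e k) x i 0)%R)%E
    @ \oo --> 0%E }.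

End Noise.

(** The phase variables (e.g. the initial datum) range over an open subset D of
    a normed space V. For a fixed noise realization a solution family is a map
    z : (phase variable) -> (time) -> (space) -> R^5, and d is the Frechet
    differential in the first argument. *)

Section Realization.
Context {R : realType} {V : normedModType R}.

(* a one-form with values in R^n, at a given point of the phase space *)
Definition form1 (n : nat) := V -> 'cV[R]_n.

Definition wedge1 (f g : V -> R) (h1 h2 : V) : R := f h1 * g h2 - f h2 * g h1.

Definition wedge (n : nat) (f g : form1 n) (h1 h2 : V) : R :=
  \sum_(i < n) wedge1 (fun h => f h i 0) (fun h => g h i 0) h1 h2.

Definition phase_variation (z : V -> R -> R -> 'cV[R]_5) (th : V) (t x : R) :
    form1 5 :=
  fun h => 'd (fun th' => z th' t x) th h.

Definition omega2 (xi : form1 5) (h1 h2 : V) : R :=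
  1 / 2 * wedge xi (fun h => M_mx *m xi h) h1 h2.
Definition kappa2 (xi : form1 5) (h1 h2 : V) : R :=
  1 / 2 * wedge xi (fun h => K_mx *m xi h) h1 h2.

(* M dz + K z_x dt = grad S1(z) dt + dN on [0, T], integrated in time *)
Definition solves (T : R) (N : R -> R -> 'cV[R]_5) (z : R -> R -> 'cV[R]_5) :
    Prop :=
  forall t x : R, 0 <= t <= T ->
    M_mx *m (z t x - z 0 x) + time_integral (fun r => K_mx *m derive1 (z r) x) t =
    time_integral (fun r => gradient S1 (z r x)) t + (N t x - N 0 x).

Definition slab (D : set V) (T : R) : set (V * R * R) :=
  [set q | D q.1.1 /\ 0 <= q.1.2 <= T].

Record regular (L : R) (D : set V) (T : R) (z : V -> R -> R -> 'cV[R]_5) :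
    Prop := {
  reg_periodic : forall th (t : R), D th -> 0 <= t <= T -> periodic (z th t) L;
  reg_z : {within slab D T, continuous (fun q => z q.1.1 q.1.2 q.2)};
  reg_dx : forall th (t x : R), D th -> 0 <= t <= T -> derivable (z th t) x 1;
  reg_zx : {within slab D T, continuous (fun q => derive1 (z q.1.1 q.1.2) q.2)};
  reg_diff : forall th (t x : R), D th -> 0 <= t <= T ->
    differentiable (fun th' => z th' t x) th;
  reg_xi : forall h, {within slab D T,
    continuous (fun q => phase_variation z q.1.1 q.1.2 q.2 h)};
  reg_xi_dx : forall h th (t x : R), D th -> 0 <= t <= T ->
    derivable (fun y => phase_variation z th t y h) x 1;
  reg_xi_x : forall h, {within slab D T,
    continuous (fun q => derive1 (fun y => phase_variation z q.1.1 q.1.2 y h) q.2)} }.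

(* d rho + (\partial_x flux) dt = 0 on [0, T], integrated in time *)
Definition conservation_law (T : R) (rho flux : R -> R -> R) : Prop :=
  forall t x : R, 0 <= t <= T ->
    [/\ derivable (flux t) x 1,
        leb.-integrable `[0, t] (EFin \o (fun r => derive1 (flux r) x))
      & rho t x - rho 0 x + \int[leb]_(r in `[0, t]) derive1 (flux r) x = 0].

End Realization.

(* Main.v *)
Require Import Defs.
From HB Require Import structures.
From mathcomp Require Import all_boot all_order all_algebra.
From mathcomp Require Import all_classical all_reals all_analysis.
From mathcomp Require Import ring lra.

Import Order.TTheory GRing.Theory Num.Theory.
Import numFieldNormedType.Exports.

Local Open Scope classical_set_scope.
Local Open Scope ring_scope.

(** The noise is additive and does not depend on the phase variables, so the
    variation xi = (U, Phi, W, V, P) of the integrated equation satisfies, path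
    by path, the noise-free linear equation
    M (xi(t) - xi(0)) = \int_0^t (Hess S1(z) xi - K xi_x) dr,
    where d(z_x) = (dz)_x by a Schwarz-type exchange of derivatives.
    Hence M xi is differentiable in time although xi itself need not be, and
    this is enough: omega = U_1 Q_2 - U_2 Q_1 with Q = (Phi - P) / 2 depends on
    xi only through M xi.  Symmetry of the Hessian and skew symmetry of K
    give omega' = - kappa_x, which is then integrated over [0, t]. *)

Local Notation leb := (@lebesgue_measure _).

(** * Mean values and the exchange of partial derivatives *)

(** Difference quotients are taken on both sides of the base point, so a closed ball about [a]
    replaces an oriented interval and spares later case distinctions on the sign of b - a. *)
Lemma MVT_ball (R : realType) (f df : R -> R) (a b : R) :
  (forall x, `|x - a| <= `|b - a| -> is_derive x 1 f (df x)) ->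
  exists2 c, `|c - a| <= `|b - a| & f b - f a = df c * (b - a).
Proof.
move=> dfP; have [ab|ba|<-] := ltgtP a b.
- have sub x : x \in `[a, b] -> `|x - a| <= `|b - a|.
    rewrite in_itv/= => /andP[? ?].
    by rewrite !ger0_norm ?subr_ge0 ?lerD2r// ltW.
  have [||c cab ->] := @MVT R f df a b ab.
  + by move=> x xab; apply/dfP/sub/subset_itv_oo_cc.
  + by apply: derivable_within_continuous => x /sub/dfP[].
  by exists c => //; apply/sub/subset_itv_oo_cc.
- have sub x : x \in `[b, a] -> `|x - a| <= `|b - a|.
    rewrite in_itv/= => /andP[? ?].
    by rewrite !ler0_norm ?subr_le0 ?lerN2 ?lerD2r// ltW.
  have [||c cab E] := @MVT R f df b a ba.
  + by move=> x xab; apply/dfP/sub/subset_itv_oo_cc.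
  + by apply: derivable_within_continuous => x /sub/dfP[].
  exists c; first exact/sub/subset_itv_oo_cc.
  by rewrite -opprB E -mulrN opprB.
- by exists a; rewrite ?subrr ?mulr0.
Qed.

(* No differentiability of [fx] is assumed: letting [y] tend to [x0] in the
   double difference quotient, which equals a value of [k] by two applications
   of the mean value theorem, yields it. *)
Lemma is_derive_swap_partials (R : realType) (f g k : R -> R -> R)
    (fx : R -> R) (e0 x0 d : R) : 0 < d ->
  (forall e y : R, `|e - e0| < d -> is_derive e 1 (f^~ y) (g e y)) ->
  (forall e y : R, `|e - e0| < d -> is_derive y 1 (g e) (k e y)) ->
  (forall e, `|e - e0| < d -> is_derive x0 1 (f e) (fx e)) ->
  {for (e0, x0), continuous (fun q => k q.1 q.2)} ->
  is_derive e0 1 fx (k e0 x0).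
Proof.
move=> d0 fe gx fxP kc.
suff H : (fun h : R => h^-1 *: (fx (h + e0) - fx e0)) @ 0^' --> k e0 x0.
  have H' : (fun h : R => h^-1 *: (fx (h *: 1 + e0) - fx e0)) @ 0^' -->
      k e0 x0.
    by under eq_fun do rewrite scaler1.
  split; first by apply/cvg_ex; exists (k e0 x0).
  exact/cvg_lim.
apply/cvgrPdist_le => /= eps eps0.
move/cvgrPdist_le : kc => /(_ _ eps0) /nbhs_ballP[rho /= rho0 krho].
near=> h.
have h0 : h != 0 by near: h; exact: nbhs_dnbhs_neq.
have hd : `|h| < d by near: h; exact: dnbhs0_lt.
have hrho : `|h| < rho by near: h; exact: dnbhs0_lt.
have he : h + e0 - e0 = h by rewrite addrK.
pose Q (s : R) := h^-1 * (s^-1 * ((f (h + e0) (s + x0) - f e0 (s + x0)) -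
  (f (h + e0) x0 - f e0 x0))).
(* With [h] fixed and [s] tending to 0, the inner quotients tend to [fx] at h + e0 and at e0. *)
have QP : Q @ 0^' --> h^-1 * (fx (h + e0) - fx e0).
  apply: cvgM; first exact: cvg_cst.
  have l e : `|e - e0| < d ->
      (fun s : R => s^-1 * (f e (s + x0) - f e x0)) @ 0^' --> fx e.
    move=> ed; have [dv vE] := fxP e ed.
    have := dv; rewrite /derivable => /cvg_ex[l lP].
    rewrite -vE /derive (cvg_lim _ lP)//.
    by move: lP; under eq_fun do rewrite scaler1.
  rewrite [X in X @ _ --> _](_ : _ = (fun s : R =>
      s^-1 * (f (h + e0) (s + x0) - f (h + e0) x0) -
      s^-1 * (f e0 (s + x0) - f e0 x0))); last by apply/funext => s; ring.
  by apply: cvgB; apply: l; rewrite ?he// subrr normr0.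
have {}QP : (fun s => `|k e0 x0 - Q s|) @ 0^' -->
    `|k e0 x0 - h^-1 * (fx (h + e0) - fx e0)|.
  by apply: cvg_norm; apply: cvgB => //; exact: cvg_cst.
(* The non-strict bound by [eps] survives the limit in [s]. It is therefore enough to bound |k e0 x0
   - Q s| for small nonzero [s], with [h] kept fixed. *)
rewrite -(cvg_lim _ QP)//; apply: limr_le; first by apply/cvg_ex; eexists; exact: QP.
near=> s.
have s0 : s != 0 by near: s; exact: nbhs_dnbhs_neq.
have srho : `|s| < rho by near: s; exact: dnbhs0_lt.
have xs : s + x0 - x0 = s by rewrite addrK.
have [|c] := @MVT_ball R (fun e => f e (s + x0) - f e x0)
    (fun e => g e (s + x0) - g e x0) e0 (h + e0).
  move=> e; rewrite he => eh; apply: is_deriveB; apply: fe;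
    exact: le_lt_trans hd.
rewrite he => ch E1.
have [|y] := @MVT_ball R (g c) (k c) x0 (s + x0).
  by move=> y _; apply: gx; exact: le_lt_trans hd.
rewrite xs => ys E2.
have -> : Q s = k c y.
  rewrite /Q; have -> : f (h + e0) (s + x0) - f e0 (s + x0) -
      (f (h + e0) x0 - f e0 x0) =
      f (h + e0) (s + x0) - f (h + e0) x0 - (f e0 (s + x0) - f e0 x0) by ring.
  by rewrite E1 E2; field; rewrite s0 h0.
have : ball (e0, x0) rho (c, y).
  split; rewrite /ball/= distrC.
    exact: le_lt_trans ch hrho.
  exact: le_lt_trans ys srho.
by move/krho.
Unshelve. all: by end_near. Qed.

(** * Relative continuity, coordinates and derivatives along lines *)

Lemma within_continuous_comp_homo (T U W : topologicalType) (A : set T) (B : set U)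
    (g : T -> U) (f : U -> W) :
  {within B, continuous f} -> {homo g : x / A x >-> B x} -> continuous g ->
  {within A, continuous (f \o g)}.
Proof.
move=> /subspace_continuousP fB gAB cg; apply/subspace_continuousP => x Ax.
apply: cvg_trans (fB _ (gAB _ Ax)) => S.
move/cg; rewrite /nbhs/=; apply: filterS => y + Ay.
by apply; exact: gAB.
Qed.

Lemma continuous_within_interior (T U : topologicalType) (A : set T)
    (f : T -> U) (x : T) :
  {within A, continuous f} -> nbhs x A -> {for x, continuous f}.
Proof.
move=> /subspace_continuousP fA /[dup] /nbhs_singleton Ax nA.
by have := fA x Ax; rewrite within_interior.
Qed.

Lemma within_continuous_coord (R : numFieldType) (T : topologicalType) (n : nat)
    (A : set T) (f : T -> 'cV[R]_n) (i : 'I_n) :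
  {within A, continuous f} -> {within A, continuous (fun x => f x i 0)}.
Proof.
move=> /subspace_continuousP fA; apply/subspace_continuousP => x Ax.
exact: (cvg_comp _ _ (fA x Ax) (@coord_continuous _ _ _ i 0 _)).
Qed.

Lemma is_derive_coord (R : realFieldType) (V : normedModType R) (n : nat)
    (f : V -> 'cV[R]_n) (x v : V) (df : 'cV[R]_n) (i : 'I_n) :
  is_derive x v f df -> is_derive x v (fun y => f y i 0) (df i 0).
Proof.
move=> [fx <-]; split.
  by move/derivable_mxP : fx => /(_ i 0).
by rewrite derive_mx// mxE.
Qed.

Lemma is_derive_line (R : realFieldType) (V W : normedModType R) (f : V -> W)
    (x v : V) (e : R) (df : W) :
  is_derive (x + e *: v) v f df -> is_derive e 1 (fun s => f (x + s *: v)) df.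
Proof.
move=> [fx <-].
have E : (fun h : R => h^-1 *: (f (x + (h *: 1 + e) *: v) - f (x + e *: v))) =
    (fun h => h^-1 *: (f (h *: v + (x + e *: v)) - f (x + e *: v))).
  apply/funext => h; rewrite scalerDl [X in X + _ *: v](_ : _ = h *: v).
    by rewrite addrCA.
  by rewrite scaler1.
by split; rewrite /derivable /derive/= E.
Qed.

(** * Integrals depending on a parameter and the fundamental theorem of calculus *)

Lemma integrable_continuous_itv (R : realType) (f : R -> R) (a b : R) :
  {within `[a, b], continuous f} -> leb.-integrable `[a, b] (EFin \o f).
Proof. by apply: continuous_compact_integrable; exact: segment_compact. Qed.

(** Joint continuity bounds [k] on the compact rectangle [-d/2, d/2] x [0, t], and the constant
    bound dominates the derivative in [e]. Halving [d] provides a closed interval inside |e| < d. *)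
Lemma is_derive_under_integral (R : realType) (f k : R -> R -> R) (d t : R) :
  0 < d ->
  (forall e, `|e| < d -> {within `[0, t], continuous (f e)}) ->
  (forall e r : R, `|e| < d -> 0 <= r <= t -> is_derive e 1 (f^~ r) (k e r)) ->
  {within [set q : R * R | `|q.1| < d /\ 0 <= q.2 <= t],
    continuous (fun q => k q.1 q.2)} ->
  is_derive (0 : R) 1 (fun e => \int[leb]_(r in `[0, t]) f e r)
    (\int[leb]_(r in `[0, t]) k 0 r).
Proof.
move=> d0 fc fk kc.
have d20 : 0 < d / 2 by rewrite divr_gt0.
have dd2 : d / 2 < d by lra.
have [C Ck] : exists C : R, forall e r, `|e| <= d / 2 -> 0 <= r <= t ->
    `|k e r| <= C.
  have : compact ((fun q : R * R => k q.1 q.2) @` (`[- (d / 2), d / 2] `*` `[0, t])).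
    apply: continuous_compact; last first.
      by apply: compact_setX; exact: segment_compact.
    apply: continuous_subspaceW kc => -[e r] [/=]; rewrite !in_itv/= => eI ->.
    by split => //; rewrite (le_lt_trans _ dd2)// ler_norml.
  move/compact_bounded => [C [_ /(_ (C + 1))]] CP; exists (C + 1) => e r ed rt.
  apply: CP; first by rewrite ltrDl.
  by exists (e, r) => //; split; rewrite /= in_itv//= -ler_norml.
have I0 : `](- (d / 2)), (d / 2)[%classic (0 : R) by rewrite /= in_itv/=; lra.
have Id e : `](- (d / 2)), (d / 2)[%classic e -> `|e| <= d / 2.
  by rewrite /= in_itv/= => eI; rewrite ler_norml; lra.
have Idd e : `](- (d / 2)), (d / 2)[%classic e -> `|e| < d.
  by move=> /Id ed; exact: le_lt_trans dd2.
have fI e : `](- (d / 2)), (d / 2)[%classic e ->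
    leb.-integrable `[0, t] (EFin \o f e).
  by move=> /Idd/fc; exact: integrable_continuous_itv.
have f1 e r : `](- (d / 2)), (d / 2)[%classic e -> `[0, t]%classic r ->
    derivable (f^~ r) e 1.
  by move=> /Idd ed; rewrite /= in_itv/= => rt; have [] := fk e r ed rt.
have p1 e r : `|e| < d -> `[0, t]%classic r -> partial1of2 f e r = k e r.
  move=> ed; rewrite /= in_itv/= => rt.
  by rewrite partial1of2E; have [] := fk e r ed rt.
have C0 (r : R) : 0 <= `|C| by [].
have CI : leb.-integrable `[0, t] (EFin \o (fun=> `|C|)).
  by apply: integrable_continuous_itv => x; exact: cvg_cst.
have ub e r : `](- (d / 2)), (d / 2)[%classic e -> `[0, t]%classic r ->
    `|partial1of2 f e r| <= `|C|.
  move=> eI rt; rewrite (p1 e r (Idd e eI) rt).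
  move: rt; rewrite /= in_itv/= => rt.
  exact: le_trans (Ck e r (Id e eI) rt) (ler_norm C).
have m : measurable (`[0, t]%classic : set (measurableTypeR R)) by [].
split.
  exact: (derivable_under_integral m I0 fI f1 C0 CI ub).
rewrite -derive1E (differentiation_under_integral m I0 fI f1 C0 CI ub).
apply: eq_Rintegral => r; rewrite inE => rt.
by rewrite p1// normr0.
Qed.

(** Near an interior time, [c] is a constant plus a primitive of [f]. This turns an equation
    integrated in time into a pointwise one, away from 0 and [T]. *)
Lemma is_derive_primitive (R : realType) (c f : R -> R) (T t : R) :
  {within `[0, T], continuous f} ->
  (forall r : R, 0 <= r <= T -> c r - c 0 = \int[leb]_(q in `[0, r]) f q) ->
  0 < t < T -> is_derive t 1 c (f t).
Proof.
move=> fc cf /andP[t0 tT].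
have ft : {for t, continuous f}.
  apply: continuous_within_interior fc _.
  have := @near_in_itvoo R 0 T t; rewrite in_itv/= t0 tT => /(_ isT).
  by apply: filterS => x; exact: subset_itv_oo_cc.
have [] := @continuous_FTC1_closed R f 0 t T tT
  (integrable_continuous_itv _ _ _ _ fc) t0 ft.
move=> dF FE.
have FE' : is_derive t 1 (fun x => (\int[leb]_(q in `[0, x]) f q) + c 0) (f t).
  rewrite -[f t]addr0; apply: is_deriveD.
  by split; [exact: dF|rewrite -derive1E].
apply: near_eq_is_derive FE'.
have := @near_in_itvoo R 0 T t; rewrite in_itv/= t0 tT => /(_ isT).
apply: filterS => x /=; rewrite in_itv/= => /andP[/ltW ? /ltW ?].
by rewrite -cf ?subrK//; apply/andP.
Qed.

(** Derivatives are asked for on the open interval only, since the differential equation of the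
    variation will be available only at interior times; continuity takes care of the endpoints. *)
Lemma Rintegral_derive (R : realType) (F f : R -> R) (t : R) :
  0 <= t ->
  {within `[0, t], continuous f} -> {within `[0, t], continuous F} ->
  (forall r : R, 0 < r < t -> is_derive r 1 F (f r)) ->
  \int[leb]_(r in `[0, t]) f r = F t - F 0.
Proof.
rewrite le_eqVlt => /predU1P[<- _ _ _|t0 fc Fc FP].
  by rewrite set_itv1 Rintegral_set1 subrr.
rewrite /Rintegral (@continuous_FTC2 _ f F)//.
- move/(continuous_within_itvP _ t0) : Fc => [_ ? ?].
  by split => // r; rewrite in_itv/= => /FP[].
- by move=> r; rewrite in_itv/= derive1E => /FP[].
Qed.

(** * Coordinatewise derivatives and products with constant matrices *)

Lemma is_derive_coordP (R : realFieldType) (V : normedModType R) (n : nat)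
    (f : V -> 'cV[R]_n) (x v : V) (df : 'cV[R]_n) :
  (forall i, is_derive x v (fun y => f y i 0) (df i 0)) -> is_derive x v f df.
Proof.
move=> fP; have fx : derivable f x v.
  by apply/derivable_mxP => i j; rewrite ord1; have [] := fP i.
split => //; apply/colP => i; rewrite derive_mx// mxE.
by have [] := fP i.
Qed.

Lemma is_derive_mulmx (R : realFieldType) (V : normedModType R) (m n : nat)
    (A : 'M[R]_(m, n)) (f : V -> 'cV[R]_n) (x v : V) (df : 'cV[R]_n) (i : 'I_m) :
  is_derive x v f df ->
  is_derive x v (fun y => (A *m f y) i 0) ((A *m df) i 0).
Proof.
move=> fP; rewrite mxE.
rewrite (_ : (fun y => _) = \sum_(j < n) (fun y => A i j *: f y j 0)).
  by apply: is_derive_sum => j; apply: is_deriveZ; exact: is_derive_coord.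
by apply/funext => y; rewrite mxE fct_sumE.
Qed.

Lemma within_continuous_mulmx (R : numFieldType) (T : topologicalType)
    (m n : nat) (A : 'M[R]_(m, n)) (B : set T) (f : T -> 'cV[R]_n) (i : 'I_m) :
  {within B, continuous f} ->
  {within B, continuous (fun y => (A *m f y) i 0)}.
Proof.
move=> fB; rewrite (_ : (fun y => _) = fun y => \sum_(j < n) A i j * f y j 0).
  move: fB => /subspace_continuousP fB; apply/subspace_continuousP => x Bx.
  apply: cvg_big => [|j _]; first exact: add_continuous.
   apply: cvgM; first exact: cvg_cst.
  exact: (cvg_comp _ _ (fB x Bx) (@coord_continuous _ _ _ j 0 _)).
by apply/funext => y; rewrite mxE.
Qed.

(** * The matrices, the gradient of [S1] and its Hessian in coordinates *)

Lemma sum_phase_coords (R : nmodType) (F : 'I_5 -> R) :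
  \sum_(i < 5) F i = F iu + F iphi + F iw + F iv + F ip.
Proof.
rewrite !big_ord_recl big_ord0 addr0 !addrA.
by congr (F _ + F _ + F _ + F _ + F _); exact: val_inj.
Qed.

Lemma mulmx_M (R : realType) (z : 'cV[R]_5) :
  M_mx *m z = col_of_seq 5 [:: 1 / 2 * (z iphi 0 - z ip 0);
    - (1 / 2 * z iu 0); 0; 0; 1 / 2 * z iu 0].
Proof.
by apply/colP => -[[|[|[|[|[|//]]]]] i5];
  rewrite !mxE sum_phase_coords !mxE/=; ring.
Qed.

Lemma mulmx_K (R : realType) (z : 'cV[R]_5) :
  K_mx *m z = col_of_seq 5 [:: - z iv 0; z iw 0; - z iphi 0; z iu 0; 0].
Proof.
by apply/colP => -[[|[|[|[|[|//]]]]] i5];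
  rewrite !mxE sum_phase_coords !mxE/=; ring.
Qed.

(** Squares are written as products, so that [derive_coords] and [continuous_coords] get by with
    sums and products. *)
Definition gradS1 {R : realType} (z : 'cV[R]_5) : 'cV[R]_5 :=
  let u := z iu 0 in let w := z iw 0 in let v := z iv 0 in let p := z ip 0 in
  col_of_seq 5
    [:: - w - 3 / 2 * (u * u) - 1 / 2 * (p * p); 0; - u; p; v - u * p].

(* the Hessian of S1 at z, applied to xi *)
Definition hessS1 {R : realType} (z xi : 'cV[R]_5) : 'cV[R]_5 :=
  let u := z iu 0 in let p := z ip 0 in
  let du := xi iu 0 in let dw := xi iw 0 in
  let dv := xi iv 0 in let dp := xi ip 0 in
  col_of_seq 5
    [:: - dw - 3 * (u * du) - p * dp; 0; - du; dp; dv - (du * p + u * dp)].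

Ltac derive_coords := repeat first
  [ exact: is_derive_cst | apply: is_deriveB | apply: is_deriveN
  | apply: is_deriveD | apply: is_deriveM
  | (apply: is_derive_coord; eassumption) ].

Lemma is_derive_gradS1 (R : realType) (V : normedModType R) (f : V -> 'cV[R]_5)
    (x v : V) (df : 'cV[R]_5) (i : 'I_5) :
  is_derive x v f df ->
  is_derive x v (fun y => gradS1 (f y) i 0) (hessS1 (f x) df i 0).
Proof.
move=> fP; case: i => -[|[|[|[|[|//]]]]] i5;
  under eq_fun do rewrite mxE/=; rewrite mxE/=.
all: by apply: is_derive_eq; first [derive_coords|idtac];
  rewrite /GRing.scale//=; field.
Qed.

Lemma gradient_S1 (R : realType) (z : 'cV[R]_5) : gradient S1 z = gradS1 z.
Proof.
apply/colP => i; rewrite mxE.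
(* [derive_coords] closes its leaves with a derivative of a vector-valued map found in the context;
   here that map is the identity. *)
have idP : is_derive z (delta_mx i 0) (fun y : 'cV[R]_5 => y) (delta_mx i 0).
  exact: is_derive_id.
suff [_ ->//] : is_derive z (delta_mx i 0) (@S1 R) (gradS1 z i 0).
rewrite (_ : @S1 R = fun z => - (z iw 0 * z iu 0) -
  1 / 2 * (z iu 0 * (z iu 0 * z iu 0)) -
  1 / 2 * z iu 0 * (z ip 0 * z ip 0) + z ip 0 * z iv 0); last first.
  by apply/funext => y; rewrite /S1/=; ring.
apply: is_derive_eq; first by derive_coords.
rewrite /GRing.scale/=.
by case: i idP => -[|[|[|[|[|//]]]]] i5 _; rewrite !mxE/=; field.
Qed.

Ltac continuous_coords := repeat lazymatch goal with
  | |- (fun _ => _ - _) @ _ --> _ => apply: cvgB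
  | |- (fun _ => - _) @ _ --> _ => apply: cvgN
  | |- (fun _ => _ * _) @ _ --> _ => apply: cvgM
  | |- (fun _ => _ + _) @ _ --> _ => apply: cvgD
  | |- (fun _ => fun_of_matrix _ _ _) @ _ --> _ =>
      match goal with H : forall i, _ --> _ |- _ => exact: H end
  | |- _ => exact: cvg_cst
  end.

Lemma within_continuous_gradS1 (R : realType) (T : topologicalType) (A : set T)
    (f : T -> 'cV[R]_5) (i : 'I_5) :
  {within A, continuous f} ->
  {within A, continuous (fun y => gradS1 (f y) i 0)}.
Proof.
move=> fA; case: i => -[|[|[|[|[|//]]]]] i5; under eq_fun do rewrite mxE/=;
  apply/subspace_continuousP => x Ax; rewrite /from_subspace/=.
all: have fc i := (subspace_continuousP _ _).1
  (within_continuous_coord _ _ _ _ _ i fA) x Ax.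
all: continuous_coords.
Qed.

Lemma within_continuous_hessS1 (R : realType) (T : topologicalType) (A : set T)
    (f g : T -> 'cV[R]_5) (i : 'I_5) :
  {within A, continuous f} -> {within A, continuous g} ->
  {within A, continuous (fun y => hessS1 (f y) (g y) i 0)}.
Proof.
move=> fA gA; case: i => -[|[|[|[|[|//]]]]] i5; under eq_fun do rewrite mxE/=;
  apply/subspace_continuousP => x Ax; rewrite /from_subspace/=.
all: have fc i := (subspace_continuousP _ _).1
  (within_continuous_coord _ _ _ _ _ i fA) x Ax.
all: have gc i := (subspace_continuousP _ _).1
  (within_continuous_coord _ _ _ _ _ i gA) x Ax.
all: continuous_coords.
Qed.

(** * Lines in the phase space and restrictions of the slab *)

(** Moving the phase variable along th + e h reduces differentials on [V] to derivatives in one real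
    parameter; openness of [D] keeps the whole short segment inside the family of solutions. *)
Lemma open_line (R : realType) (V : normedModType R) (D : set V) (th h : V) :
  open D -> D th ->
  exists2 d : R, 0 < d & forall e : R, `|e| < d -> D (th + e *: h).
Proof.
move=> oD Dth.
have : (fun e : R => th + e *: h) @ 0 --> th.
  rewrite -[X in _ --> X]addr0 -[X in _ --> _ + X](scale0r h).
  by apply: cvgD; [exact: cvg_cst|apply: cvgZr_tmp; exact: cvg_id].
move/(_ D (open_nbhs_nbhs (conj oD Dth))) => /nbhs_ballP[d /= d0 dD].
by exists d => // e ed; apply: (dD e); rewrite /ball/= sub0r normrN.
Qed.

Lemma continuous_pair (T U W : topologicalType) (f : T -> U) (g : T -> W) :
  continuous f -> continuous g -> continuous (fun x => (f x, g x)).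
Proof. by move=> fc gc x; exact: cvg_pair (fc x) (gc x). Qed.

Lemma continuous_fst (T U : topologicalType) : continuous (@fst T U).
Proof. by move=> [x y]; exact: cvg_fst. Qed.

Lemma continuous_snd (T U : topologicalType) : continuous (@snd T U).
Proof. by move=> [x y]; exact: cvg_snd. Qed.

Lemma continuous_fst_line (R : realType) (V : normedModType R) (th h : V) :
  continuous (fun q : R * R => th + q.1 *: h).
Proof.
move=> q; apply: cvgD; first exact: cvg_cst.
by apply: cvgZr_tmp; exact: continuous_fst.
Qed.

Lemma within_continuous_slab_time (R : realType) (V : normedModType R)
    (U : topologicalType) (D : set V) (T t x : R) (th : V)
    (f : V * R * R -> U) :
  D th -> t <= T -> {within slab D T, continuous f} ->
  {within `[0, t], continuous (fun r => f (th, r, x))}.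
Proof.
move=> Dth tT fc; apply: (within_continuous_comp_homo _ _ _ _ _
  (fun r : R => (th, r, x)) _ fc).
  by move=> r /=; rewrite in_itv/= => rt; split => //=; lra.
apply: continuous_pair; last by move=> q; exact: cvg_cst.
by apply: continuous_pair => q; [exact: cvg_cst|exact: cvg_id].
Qed.

(** * The variation of the equation integrated in time *)

Lemma is_derive_phase_variation (R : realType) (V : normedModType R)
    (z : V -> R -> R -> 'cV[R]_5) (th h : V) (t x : R) :
  differentiable (fun th' => z th' t x) th ->
  is_derive th h (fun th' => z th' t x) (phase_variation z th t x h).
Proof. by move=> zth; split; [exact: diff_derivable|rewrite deriveE]. Qed.

Lemma is_derive1 (R : realType) (V : normedModType R) (f : R -> V) (x : R) :
  derivable f x 1 -> is_derive x 1 f (derive1 f x).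
Proof. by move=> fx; split => //; rewrite derive1E. Qed.

(** This is d(z_x) = (dz)_x along a line, obtained from [is_derive_swap_partials] in each
    coordinate: [z], its variation, and the space derivative of the variation play the roles of [f],
    [g] and [k]. *)
Lemma variation_derive1 (R : realType) (V : normedModType R) (L T : R)
    (D : set V) (z : V -> R -> R -> 'cV[R]_5) (th h : V) (d e t x : R) :
  regular L D T z -> (forall e, `|e| < d -> D (th + e *: h)) ->
  `|e| < d -> 0 <= t <= T ->
  is_derive e 1 (fun s => derive1 (z (th + s *: h) t) x)
    (derive1 (fun y => phase_variation z (th + e *: h) t y h) x).
Proof.
move=> zreg dD ed tT; apply: is_derive_coordP => i.
(* The radius d - |e| around [e] stays inside the interval |s| < d on which the line lies in [D]. *)
have de0 : 0 < d - `|e| by rewrite subr_gt0.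
have near_e s : `|s - e| < d - `|e| -> `|s| < d.
  move=> se; rewrite -[s](subrK e) (le_lt_trans (ler_normD _ _))//.
  by rewrite -ltrBrDr.
apply: (@is_derive_swap_partials R
  (fun s y => z (th + s *: h) t y i 0)
  (fun s y => phase_variation z (th + s *: h) t y h i 0)
  (fun s y => derive1 (fun y => phase_variation z (th + s *: h) t y h) y i 0)
  _ e x _ de0).
- move=> s y /near_e/dD Ds.
  apply: (is_derive_line _ _ _ (fun th' => z th' t y i 0)).
  by apply: is_derive_coord; apply: is_derive_phase_variation;
    exact: (reg_diff zreg).
- move=> s y /near_e/dD Ds.
  by apply: is_derive_coord; apply: is_derive1; exact: (reg_xi_dx zreg).
- move=> s /near_e/dD Ds.
  by apply: is_derive_coord; apply: is_derive1; exact: (reg_dx zreg).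
(* Time is frozen at [t], so only |s| < d constrains the pair (s, y). This set is a neighbourhood of
   (e, x), hence relative continuity on the slab becomes genuine continuity, even when [t] is 0 or
   [T]. *)
apply: (@continuous_within_interior _ _ [set q : R * R | `|q.1| < d]).
  apply: within_continuous_coord.
  apply: (within_continuous_comp_homo _ _ _ _ _
    (fun q : R * R => (th + q.1 *: h, t, q.2)) _ (reg_xi_x (h:=h) zreg)).
    by move=> q /= /dD.
  apply: continuous_pair; last exact: continuous_snd.
  apply: continuous_pair; last by move=> q; exact: cvg_cst.
  exact: continuous_fst_line.
have : (fun q : R * R => `|q.1|) @ (e, x) --> `|e|.
  by apply: cvg_norm; exact: (continuous_fst _ _ (e, x)).
by move/cvgr_lt; apply.
Qed.

(** The integrated equation at th + e h is differentiated at e = 0. The same noise increment occurs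
    for every [e] and drops out, while the derivative passes under the time integral. *)
Lemma integrated_variation (R : realType) (V : normedModType R) (L T : R)
    (D : set V) (N : R -> R -> 'cV[R]_5) (z : V -> R -> R -> 'cV[R]_5)
    (th h : V) (t x : R) (i : 'I_5) :
  open D -> regular L D T z -> (forall th, D th -> solves T N (z th)) ->
  D th -> 0 <= t <= T ->
  (M_mx *m phase_variation z th t x h) i 0 -
  (M_mx *m phase_variation z th 0 x h) i 0 =
  \int[leb]_(r in `[0, t])
    (hessS1 (z th r x) (phase_variation z th r x h) i 0 -
     (K_mx *m derive1 (fun y => phase_variation z th r y h) x) i 0).
Proof.
move=> oD zreg zsol Dth tT.
have [d d0 dD] := open_line R V D th h oD Dth.
have tT' : t <= T by lra.
have rT (r : R) : 0 <= r <= t -> 0 <= r <= T by lra.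
pose slab1 := [set q : R * R | `|q.1| < d /\ 0 <= q.2 <= t].
have slab1P (f : V * R * R -> 'cV[R]_5) : {within slab D T, continuous f} ->
    {within slab1, continuous (fun q => f (th + q.1 *: h, q.2, x))}.
  move=> fc; apply: (within_continuous_comp_homo _ _ _ _ _
    (fun q : R * R => (th + q.1 *: h, q.2, x)) _ fc).
    by move=> q [/= /dD ? /rT].
  apply: continuous_pair; last by move=> q; exact: cvg_cst.
  by apply: continuous_pair; [exact: continuous_fst_line|exact: continuous_snd].
(* [G] is the derivative of [F] in [e]; [A] is the increment of M z, whose derivative at e = 0 will
   be computed in two ways. *)
pose F e r := gradS1 (z (th + e *: h) r x) i 0 -
  (K_mx *m derive1 (z (th + e *: h) r) x) i 0.
pose G e r := hessS1 (z (th + e *: h) r x)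
    (phase_variation z (th + e *: h) r x h) i 0 -
  (K_mx *m derive1 (fun y => phase_variation z (th + e *: h) r y h) x) i 0.
pose A e := (M_mx *m z (th + e *: h) t x) i 0 - (M_mx *m z (th + e *: h) 0 x) i 0.
have gradc e : `|e| < d ->
    {within `[0, t], continuous (fun r => gradS1 (z (th + e *: h) r x) i 0)}.
  move=> ed; apply: within_continuous_gradS1.
  exact: (within_continuous_slab_time _ _ _ _ T _ _ _
    (fun q => z q.1.1 q.1.2 q.2) (dD e ed) tT' (reg_z zreg)).
have Kc e : `|e| < d -> {within `[0, t],
    continuous (fun r => (K_mx *m derive1 (z (th + e *: h) r) x) i 0)}.
  move=> ed; apply: within_continuous_mulmx.
  exact: (within_continuous_slab_time _ _ _ _ T _ _ _
    (fun q => derive1 (z q.1.1 q.1.2) q.2) (dD e ed) tT' (reg_zx zreg)).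
have zd (e r : R) : `|e| < d -> 0 <= r <= t ->
    is_derive e 1 (fun s => z (th + s *: h) r x)
      (phase_variation z (th + e *: h) r x h).
  move=> ed rt; apply: (is_derive_line _ _ _ (fun th' => z th' r x)).
  apply: is_derive_phase_variation.
  by apply: (reg_diff zreg); [exact: dD|exact: rT].
have FG : is_derive (0 : R) 1 (fun e => \int[leb]_(r in `[0, t]) F e r)
    (\int[leb]_(r in `[0, t]) G 0 r).
  apply: (is_derive_under_integral _ _ _ d) => //.
  - by move=> e ed; apply: within_continuousB; [exact: gradc|exact: Kc].
  - move=> e r ed rt; apply: is_deriveB.
      by apply: is_derive_gradS1; exact: zd.
    by apply: is_derive_mulmx; apply: variation_derive1 dD ed (rT _ rt); exact: zreg.
  - apply: within_continuousB.
      apply: within_continuous_hessS1.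
        exact: (slab1P (fun q => z q.1.1 q.1.2 q.2) (reg_z zreg)).
      exact: (slab1P (fun q => phase_variation z q.1.1 q.1.2 q.2 h)
        (reg_xi (h:=h) zreg)).
    apply: within_continuous_mulmx.
    exact: (slab1P (fun q => derive1 (fun y => phase_variation z q.1.1 q.1.2 y h) q.2)
      (reg_xi_x (h:=h) zreg)).
(* Row [i] of the equation, solved for the increment of M z: the noise contributes a constant in
   [e]. *)
have AF e : `|e| < d ->
    A e = (\int[leb]_(r in `[0, t]) F e r) + (N t x i 0 - N 0 x i 0).
  move=> ed.
  have := zsol _ (dD e ed) t x tT => /(congr1 (fun v : 'cV[R]_5 => v i 0)).
  have colD (u v : 'cV[R]_5) : (u + v) i 0 = u i 0 + v i 0 by rewrite mxE.
  have colN (u : 'cV[R]_5) : (- u) i 0 = - u i 0 by rewrite mxE.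
  have ti (f : R -> 'cV[R]_5) :
      time_integral f t i 0 = \int[leb]_(r in `[0, t]) f r i 0 by rewrite mxE.
  have -> : (fun r => gradient S1 (z (th + e *: h) r x)) =
      (fun r => gradS1 (z (th + e *: h) r x)).
    by apply/funext => r; exact: gradient_S1.
  rewrite mulmxBr !colD !colN !ti /F RintegralB//;
    [|exact: integrable_continuous_itv (gradc e ed)
     |exact: integrable_continuous_itv (Kc e ed)].
  by rewrite -/(A e) => E; rewrite -[A e](addrK (\int[leb]_(r in `[0, t])
    (K_mx *m derive1 (z (th + e *: h) r) x) i 0)) E addrAC.
have dA : is_derive (0 : R) 1 A ((M_mx *m phase_variation z th t x h) i 0 -
    (M_mx *m phase_variation z th 0 x h) i 0).
  have dM r : 0 <= r <= t -> is_derive (0 : R) 1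
      (fun e => (M_mx *m z (th + e *: h) r x) i 0)
      ((M_mx *m phase_variation z th r x h) i 0).
    move=> rt; apply: is_derive_mulmx.
    by have := zd 0 r; rewrite normr0 scale0r addr0; apply.
  by apply: is_deriveB; apply: dM; lra.
have dA' : is_derive (0 : R) 1 A (\int[leb]_(r in `[0, t]) G 0 r).
  rewrite -[X in is_derive _ _ _ X]addr0.
  apply: (near_eq_is_derive _ (is_deriveD FG (is_derive_cst (N t x i 0 - N 0 x i 0) _ _))).
  apply: filterS (nbhsx_ballx (0 : R) d d0) => e.
  by rewrite /ball/= sub0r normrN => /AF ->.
(* Both values are the derivative of [A] at 0, hence they agree. *)
rewrite -(@derive_val _ _ _ _ _ _ _ dA) (@derive_val _ _ _ _ _ _ _ dA').
by rewrite /G scale0r addr0.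
Qed.

(** * The two-forms in coordinates and the pointwise equations of the variation *)

Lemma omega2E (R : realType) (V : normedModType R) (xi : form1 5) (h1 h2 : V) :
  omega2 xi h1 h2 =
  1 / 2 * wedge1 (fun h => xi h iu 0) (fun h => xi h iphi 0) h1 h2 -
  1 / 2 * wedge1 (fun h => xi h iu 0) (fun h => xi h ip 0) h1 h2 :> R.
Proof.
by rewrite /omega2 /wedge sum_phase_coords /wedge1 !mulmx_M !mxE/=; field.
Qed.

Lemma kappa2E (R : realType) (V : normedModType R) (xi : form1 5) (h1 h2 : V) :
  kappa2 xi h1 h2 =
  - wedge1 (fun h => xi h iu 0) (fun h => xi h iv 0) h1 h2 +
  wedge1 (fun h => xi h iphi 0) (fun h => xi h iw 0) h1 h2 :> R.
Proof.
by rewrite /kappa2 /wedge sum_phase_coords /wedge1 !mulmx_K !mxE/=; field.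
Qed.

Lemma is_derive_unique (R : numFieldType) (V W : normedModType R) (f : V -> W)
    (x v : V) (a b : W) : is_derive x v f a -> is_derive x v f b -> a = b.
Proof. by move=> [_ <-] [_ <-]. Qed.

Lemma is_derive_cst_eq0 (R : numFieldType) (V W : normedModType R) (c : W)
    (x v : V) (a : W) : is_derive x v (fun=> c) a -> a = 0.
Proof. by move=> [_ <-]; exact: derive_cst. Qed.

(** The integrand in [integrated_variation] is continuous in time, so the fundamental theorem of
    calculus applies to each row. *)
Lemma variation_equation (R : realType) (V : normedModType R) (L T : R)
    (D : set V) (N : R -> R -> 'cV[R]_5) (z : V -> R -> R -> 'cV[R]_5)
    (th h : V) (t x : R) (i : 'I_5) :
  open D -> regular L D T z -> (forall th, D th -> solves T N (z th)) ->
  D th -> 0 < t < T ->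
  is_derive t 1 (fun r => (M_mx *m phase_variation z th r x h) i 0)
    (hessS1 (z th t x) (phase_variation z th t x h) i 0 -
     (K_mx *m derive1 (fun y => phase_variation z th t y h) x) i 0).
Proof.
move=> oD zreg zsol Dth tT.
pose f r := hessS1 (z th r x) (phase_variation z th r x h) i 0 -
  (K_mx *m derive1 (fun y => phase_variation z th r y h) x) i 0.
have itvP f := within_continuous_slab_time _ _ 'cV[R]_5 _ T _ x th f Dth (lexx T).
apply: (is_derive_primitive _ _ f T) => //.
  apply: within_continuousB.
    apply: within_continuous_hessS1.
      exact: (itvP (fun q => z q.1.1 q.1.2 q.2) (reg_z zreg)).
    exact: (itvP (fun q => phase_variation z q.1.1 q.1.2 q.2 h) (reg_xi (h:=h) zreg)).
  apply: within_continuous_mulmx.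
  exact: (itvP (fun q => derive1 (fun y => phase_variation z q.1.1 q.1.2 y h) q.2)
      (reg_xi_x (h:=h) zreg)).
move=> r rT; apply: integrated_variation zsol Dth rT => //; exact: zreg.
Qed.

(** Rows [iw] and [iv] of [M_mx] vanish and give constraints without time derivative. Rows [iphi]
    and [ip] carry the same derivative of U/2 up to sign, and comparing them gives the constraint on
    W_x. The evolution of U and of Phi - P comes from rows [iphi] and [iu]. *)
Lemma variation_equations (R : realType) (V : normedModType R) (L T : R)
    (D : set V) (N : R -> R -> 'cV[R]_5) (z : V -> R -> R -> 'cV[R]_5)
    (th h : V) (t x : R) :
  open D -> regular L D T z -> (forall th, D th -> solves T N (z th)) ->
  D th -> 0 < t < T ->
  let xi := phase_variation z th t x h in
  let xix := derive1 (fun y => phase_variation z th t y h) x in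
  [/\ xix iphi 0 = xi iu 0, xix iu 0 = xi ip 0,
      xix iw 0 = xi iv 0 - (xi iu 0 * z th t x ip 0 + z th t x iu 0 * xi ip 0),
      is_derive t 1 (fun r => phase_variation z th r x h iu 0) (2 * xix iw 0) &
      is_derive t 1 (fun r => phase_variation z th r x h iphi 0 -
          phase_variation z th r x h ip 0)
        (2 * (hessS1 (z th t x) xi iu 0 + xix iv 0))].
Proof.
move=> oD zreg zsol Dth tT xi xix.
have eqn i := variation_equation R V L T D N z th h t x i oD zreg zsol Dth tT.
have eqw : - xi iu 0 - - xix iphi 0 = 0.
  have := eqn iw; under eq_fun do rewrite mulmx_M mxE/=.
  rewrite mulmx_K !mxE/= => dw.
  exact: is_derive_cst_eq0 dw.
have eqv : xi ip 0 - xix iu 0 = 0.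
  have := eqn iv; under eq_fun do rewrite mulmx_M mxE/=.
  rewrite mulmx_K !mxE/= => dv.
  exact: is_derive_cst_eq0 dv.
have dp : is_derive t 1 (fun r => 1 / 2 * phase_variation z th r x h iu 0)
    (xi iv 0 - (xi iu 0 * z th t x ip 0 + z th t x iu 0 * xi ip 0)).
  have := eqn ip; under eq_fun do rewrite mulmx_M mxE/=.
  by rewrite mulmx_K !mxE/= subr0.
have dphi : is_derive t 1 (fun r => 1 / 2 * phase_variation z th r x h iu 0)
    (xix iw 0).
  have := eqn iphi; under eq_fun do rewrite mulmx_M mxE/=.
  rewrite mulmx_K !mxE/= sub0r => dN.
  by have := is_deriveN dN; rewrite !opprK.
have du : is_derive t 1 (fun r => 1 / 2 * (phase_variation z th r x h iphi 0 -
    phase_variation z th r x h ip 0)) (hessS1 (z th t x) xi iu 0 + xix iv 0).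
  have := eqn iu; under eq_fun do rewrite mulmx_M mxE/=.
  by rewrite mulmx_K [X in _ - X]mxE/= opprK.
(* This clears the factor 1/2 carried by the entries of [M_mx]. *)
have dbl (f : R -> R) df : is_derive t 1 (fun r => 1 / 2 * f r) df ->
    is_derive t 1 f (2 * df).
  move=> /(is_deriveZ 2); congr (is_derive _ _ _ _).
  by apply/funext => r; change (2 * (1 / 2 * f r) = f r); field.
split.
- by lra.
- by lra.
- exact: is_derive_unique dphi dp.
- exact: dbl.
- exact: dbl.
Qed.

(** * Wedge products and the conservation law along one path *)

Lemma is_derive_wedge1 (R : realType) (V : normedModType R) (f g : R -> V -> R)
    (df dg : V -> R) (x : R) (h1 h2 : V) :
  (forall h, is_derive x 1 (f^~ h) (df h)) ->
  (forall h, is_derive x 1 (g^~ h) (dg h)) ->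
  is_derive x 1 (fun y => wedge1 (f y) (g y) h1 h2)
    (wedge1 df (g x) h1 h2 + wedge1 (f x) dg h1 h2).
Proof.
move=> fP gP.
have H : is_derive x 1 (fun y => wedge1 (f y) (g y) h1 h2)
    ((f x h1 *: dg h2 + g x h2 *: df h1) - (f x h2 *: dg h1 + g x h1 *: df h2)).
  by apply: is_deriveB; apply: is_deriveM.
apply: (is_derive_eq H).
by rewrite /wedge1 /GRing.scale/=; ring.
Qed.

Lemma within_continuous_wedge1 (R : realType) (V : normedModType R)
    (T : topologicalType) (A : set T) (f g : T -> V -> R) (h1 h2 : V) :
  (forall h, {within A, continuous (f^~ h)}) ->
  (forall h, {within A, continuous (g^~ h)}) ->
  {within A, continuous (fun x => wedge1 (f x) (g x) h1 h2)}.
Proof.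
move=> fA gA; apply/subspace_continuousP => x Ax.
have fc h := (subspace_continuousP _ _).1 (fA h) x Ax.
have gc h := (subspace_continuousP _ _).1 (gA h) x Ax.
by apply: cvgB; apply: cvgM; [exact: fc|exact: gc|exact: fc|exact: gc].
Qed.

Lemma variation_conservation (R : realType) (V : normedModType R) (L T : R)
    (D : set V) (N : R -> R -> 'cV[R]_5) (z : V -> R -> R -> 'cV[R]_5)
    (th h1 h2 : V) :
  open D -> regular L D T z -> (forall th, D th -> solves T N (z th)) ->
  D th ->
  conservation_law T
    (fun t x => omega2 (phase_variation z th t x) h1 h2)
    (fun t x => kappa2 (phase_variation z th t x) h1 h2).
Proof.
move=> oD zreg zsol Dth t x tT; have tT' : t <= T by lra.
pose xi h r := phase_variation z th r x h.
pose xix h r := derive1 (fun y => phase_variation z th r y h) x.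
have dxi h r : 0 <= r <= T ->
    is_derive x 1 (fun y => phase_variation z th r y h) (xix h r).
  by move=> rT; apply: is_derive1; exact: (reg_xi_dx zreg).
pose wd (f g : V -> R -> 'cV[R]_5) (i j : 'I_5) (r : R) : R :=
  wedge1 (fun h => f h r i 0) (fun h => g h r j 0) h1 h2.
(* The Leibniz expansion of kappa_x, in terms of the variation and its space derivative. *)
pose kx r := - (wd xix xi iu iv r + wd xi xix iu iv r) +
  (wd xix xi iphi iw r + wd xi xix iphi iw r).
have kxP r : 0 <= r <= T -> is_derive x 1
    (fun y => kappa2 (phase_variation z th r y) h1 h2) (kx r).
  move=> rT; have dc h i := is_derive_coord _ _ _ _ _ _ _ i (dxi h r rT).
  under eq_fun do rewrite kappa2E.
  by apply: is_deriveD; [apply: is_deriveN|]; apply: is_derive_wedge1 => h.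
have itvP f := within_continuous_slab_time _ _ 'cV[R]_5 _ T t x th f Dth tT'.
have xic h := itvP (fun q => phase_variation z q.1.1 q.1.2 q.2 h)
  (reg_xi (h:=h) zreg).
have xixc h := itvP (fun q => derive1 (fun y => phase_variation z q.1.1 q.1.2 y h) q.2)
  (reg_xi_x (h:=h) zreg).
have wdc f g i j : (forall h, {within `[0, t], continuous (f h)}) ->
    (forall h, {within `[0, t], continuous (g h)}) ->
    {within `[0, t], continuous (wd f g i j)}.
  by move=> fc gc; apply: within_continuous_wedge1 => h;
    apply: within_continuous_coord.
have kxc : {within `[0, t], continuous kx}.
  move=> r; apply: cvgD; [apply: cvgN|]; apply: cvgD; exact: wdc.
pose om r := omega2 (phase_variation z th r x) h1 h2.
have omc : {within `[0, t], continuous om}.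
  rewrite (_ : om = fun r => 1 / 2 * wd xi xi iu iphi r -
    1 / 2 * wd xi xi iu ip r); last by apply/funext => r; exact: omega2E.
  by move=> r; apply: cvgB; apply: cvgM;
    [exact: cvg_cst|exact: wdc|exact: cvg_cst|exact: wdc].
have omP (r : R) : 0 < r < t -> is_derive r 1 om (- kx r).
  move=> rt; have rT : 0 < r < T by lra.
  have eqs h := variation_equations R V L T D N z th h r x oD zreg zsol Dth rT.
  (* Grouping Phi - P into a single factor matters: time derivatives are available for U and for
     this difference, not for Phi and P separately. *)
  rewrite (_ : om = fun r => 1 / 2 * wedge1 (fun h => xi h r iu 0)
    (fun h => xi h r iphi 0 - xi h r ip 0) h1 h2); last first.
    by apply/funext => q; rewrite /om omega2E /wedge1 /xi; field.
  have du h : is_derive r 1 (fun q => xi h q iu 0) (2 * xix h r iw 0).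
    by have [] := eqs h.
  have dq h : is_derive r 1 (fun q => xi h q iphi 0 - xi h q ip 0)
      (2 * (hessS1 (z th r x) (xi h r) iu 0 + xix h r iv 0)).
    by have [] := eqs h.
  have dom := is_derive_wedge1 R V (fun q h => xi h q iu 0)
    (fun q h => xi h q iphi 0 - xi h q ip 0) _ _ r h1 h2 du dq.
  apply: (is_derive_eq (is_deriveZ (1 / 2) dom)).
  have e1 h : xix h r iphi 0 = xi h r iu 0 by have [] := eqs h.
  have e2 h : xix h r iu 0 = xi h r ip 0 by have [] := eqs h.
  have e3 h : xix h r iw 0 = xi h r iv 0 -
      (xi h r iu 0 * z th r x ip 0 + z th r x iu 0 * xi h r ip 0).
    by have [] := eqs h.
  have hess h : hessS1 (z th r x) (xi h r) iu 0 = - xi h r iw 0 -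
      3 * (z th r x iu 0 * xi h r iu 0) - z th r x ip 0 * xi h r ip 0.
    by rewrite mxE.
  (* After substitution of the constraints, the two terms p U ^ P, one from W_x ^ P and one from the
     Hessian row, cancel by symmetry of the Hessian. What remains is W_x ^ Phi - V ^ P - U ^ W + U ^
     V_x, which is -kappa_x because U_x = P and Phi_x = U. *)
  rewrite /kx /wd /wedge1 /GRing.scale/=.
  move: (e1 h1) (e1 h2) (e2 h1) (e2 h2) (e3 h1) (e3 h2) (hess h1) (hess h2).
  move: (xi h1 r) (xi h2 r) (xix h1 r) (xix h2 r) (z th r x) => X1 X2 Y1 Y2 Z.
  by move=> -> -> -> -> -> -> -> ->; field.
have kxE r : 0 <= r <= t ->
    derive1 (fun y => kappa2 (phase_variation z th r y) h1 h2) x = kx r.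
  by move=> rt; rewrite derive1E; have [] := kxP r; lra.
split.
- by have [] := kxP t tT.
- have := integrable_continuous_itv _ _ _ _ kxc.
  apply: eq_integrable => // r; rewrite inE/= in_itv/= => rt.
  by rewrite kxE.
- have t0 : 0 <= t by lra.
  have intE : \int[leb]_(r in `[0, t])
      derive1 (fun y => kappa2 (phase_variation z th r y) h1 h2) x =
      \int[leb]_(r in `[0, t]) kx r.
    by apply: eq_Rintegral => r; rewrite inE/= in_itv/= => /kxE.
  (* Here -omega serves as the primitive of kappa_x: differentiable inside (0, t) and continuous up
     to the endpoints. *)
  have kxI : \int[leb]_(r in `[0, t]) kx r = - om t - - om 0.
    apply: (Rintegral_derive R (fun r => - om r) kx t t0 kxc).
      by move=> r; apply: cvgN; exact: omc.
    by move=> r rt; rewrite -[kx r]opprK; apply: is_deriveN; exact: omP.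
  change (om t - om 0 + \int[leb]_(r in `[0, t])
    derive1 (fun y => kappa2 (phase_variation z th r y) h1 h2) x = 0).
  rewrite intE kxI; move: (om t) (om 0) => p q; ring.
Qed.

Theorem proposition2p2 (R : realType)
  (d : measure_display) (Omega : measurableType d) (P : probability Omega R)
  (a b s T : R) (hab : a < b) (hs : 5 / 2 < s) (hT : 0 < T)
  (e : nat -> R -> R) (beta : nat -> R -> Omega -> R)
  (hW : cylindrical_wiener P a b e beta)
  (Phi : (R -> R) -> (R -> R)) (hPhi : hilbert_schmidt a b (s - 2) Phi)
  (GW : Omega -> R -> R -> 'cV[R]_5)
  (hGW : noise_process P a b (s - 1) e beta (noise_operator a b Phi) GW)
  (V : normedModType R) (D : set V) (hD : open D)
  (z : Omega -> V -> R -> R -> 'cV[R]_5)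
  (hmeas : forall (th : V) (t x : R) (i : 'I_5), D th -> 0 <= t <= T ->
     measurable_fun setT (fun w => z w th t x i 0))
  (hsol : {ae P, forall w, forall th, D th -> solves T (GW w) (z w th)})
  (hreg : {ae P, forall w, regular (torus_length a b) D T (z w)}) :
  (forall (w : Omega) (th : V) (t x : R) (h1 h2 : V),
     let xi := phase_variation (z w) th t x in
     let du h := xi h iu 0 in let dphi h := xi h iphi 0 in
     let dw h := xi h iw 0 in let dv h := xi h iv 0 in
     let dp h := xi h ip 0 in
     omega2 xi h1 h2 =
       1 / 2 * wedge1 du dphi h1 h2 - 1 / 2 * wedge1 du dp h1 h2 /\
     kappa2 xi h1 h2 = - wedge1 du dv h1 h2 + wedge1 dphi dw h1 h2) /\
  {ae P, forall w, forall th, D th -> forall h1 h2,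
     conservation_law T
       (fun t x => omega2 (phase_variation (z w) th t x) h1 h2)
       (fun t x => kappa2 (phase_variation (z w) th t x) h1 h2)}.
Proof.
split=> [w th t x h1 h2|].
  by split; [exact: omega2E|exact: kappa2E].
(* The two almost sure events are intersected once, before the phase point and the directions are
   chosen. On the intersection the argument is deterministic, with [GW w] as a fixed forcing. *)
apply: filterS2 hsol hreg => w wsol wreg th Dth h1 h2.
exact: variation_conservation hD wreg wsol Dth.
Qed.
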